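(* Let $\mathcal{L}\subseteq\mathrm{Scat}$ be nonempty, downward $\preceq$-closed and ccs. Then in the quasi-order $\trianglelefteq^{\mathcal{L}}_{\mathrm{LO}}$ there are chains of order type $(\mathbb{R},<)$ and antichains of size $2^{\aleph_0}$.
   Context: Linear orders are reflexive and nonempty. $L\preceq L'$ means there is an embedding $f:L\to L'$, i.e. $x\le_L y\iff f(x)\le_{L'}f(y)$. $\mathrm{LO}\subseteq 2^{\mathbb{N}\times\mathbb{N}}$ is the set of (codes for) linear orders with domain $\mathbb{N}$; $\mathrm{Fin}$ is the set of (codes for) nonempty linear orders on finite subsets of $\mathbb{N}$; $\mathrm{Lin}=\mathrm{Fin}\cup\mathrm{LO}$; $\mathrm{Scat}\subseteq\mathrm{Lin}$ is the set of scattered ones (those $L$ with $\mathbb{Q}\not\preceq L$). A class $\mathcal{L}\subseteq\mathrm{Lin}$ is downward $\preceq$-closed if $K\in\mathrm{Lin}$ and $K\preceq L\in\mathcal{L}$ imply $K\in\mathcal{L}$; membership in $\mathcal{L}$ is meant up to isomorphism. A subset $I$ of a linear order $L$ is convex if $x\le_L y\le_L z$ and $x,z\in I$ imply $y\in I$. For $A,B\subseteq L$ write $A\le_L B$ (resp. $A<_L B$) if $a\le_L b$ (resp. $a<_L b$) for all $a\in A$, $b\in B$. A $K$-convex partition of $L$ is a partition $(L_k)_{k\in K}$ of $L$ (into nonempty sets) such that $k<_K k'\iff L_k<_L L_{k'}$. The relation $L\trianglelefteq^{\mathcal{L}}L'$ holds iff there are $K\in\mathcal{L}$, a $K$-convex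 partition $(L_k)_{k\in K}$ of $L$, and an embedding $f$ of $L$ into $L'$ such that $f(L_k)$ is a convex subset of $L'$ for every $k\in K$. $\trianglelefteq^{\mathcal{L}}_{\mathrm{LO}}$ is its restriction to $\mathrm{LO}$. $\mathcal{L}$ is ccs (closed under convex sums) if for all $K,K'\in\mathcal{L}$ and every family $(K'_k)_{k\in K}$ of nonempty convex subsets of $K'$ such that $k_0<_K k_1\Rightarrow K'_{k_0}\le_{K'}K'_{k_1}$, we have $\sum_{k\in K}K'_k\in\mathcal{L}$, where $\sum_{k\in K}K'_k=\{(x,k): k\in K, x\in K'_k\}$ ordered antilexicographically. When $\mathcal{L}$ is ccs, $\trianglelefteq^{\mathcal{L}}$ is a quasi-order. A chain of order type $(\mathbb{R},<)$ is a family $(L_x)_{x\in\mathbb{R}}$ in $\mathrm{LO}$ with $L_x\trianglelefteq^{\mathcal{L}}_{\mathrm{LO}}L_y\iff x\le y$; an antichain is a set of pairwise $\trianglelefteq^{\mathcal{L}}_{\mathrm{LO}}$-incomparable elements. *)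

(* Defs.v *)
From mathcomp Require Import all_boot all_order all_algebra.
From mathcomp Require Import boolp classical_sets functions cardinality reals.

Set Implicit Arguments.
Unset Strict Implicit.
Unset Printing Implicit Defensive.

Import Order.TTheory GRing.Theory Num.Theory.

Local Open Scope classical_set_scope.

(* A reflexive order on a subset of T is coded by its graph r : rel T; the     *)
(* underlying subset is recovered from the diagonal. Thus an order with domain *)
(* contained in nat is an element of 2^(nat * nat), i.e., of rel nat.          *)
Definition dom (T : Type) (r : rel T) : set T := [set x | r x x].

Definition is_linear_order (T : Type) (r : rel T) : Prop :=
  [/\ dom r !=set0,
      (forall x y, r x y -> dom r x /\ dom r y),
      (forall x y, r x y -> r y x -> x = y),
      (forall x y z, r x y -> r y z -> r x z) &
      (forall x y, dom r x -> dom r y -> r x y \/ r y x)].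

Definition strict (T : Type) (r : rel T) (x y : T) : Prop := r x y /\ x <> y.

(* Only the values of f on dom r matter; f maps dom r into dom s because       *)
(* s (f x) (f x) = r x x.                                                      *)
Definition is_embedding (T U : Type) (r : rel T) (s : rel U) (f : T -> U) :
    Prop :=
  forall x y, dom r x -> dom r y -> r x y = s (f x) (f y).

Definition embeds (T U : Type) (r : rel T) (s : rel U) : Prop :=
  exists f : T -> U, is_embedding r s f.

Definition isomorphic (T U : Type) (r : rel T) (s : rel U) : Prop :=
  exists2 f : T -> U, is_embedding r s f & f @` dom r = dom s.

Definition LO : set (rel nat) :=
  [set r | is_linear_order r /\ dom r = setT].

Definition Fin : set (rel nat) :=
  [set r | is_linear_order r /\ finite_set (dom r)].

Definition Lin : set (rel nat) := Fin `|` LO.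

Definition Scat : set (rel nat) :=
  [set r | Lin r /\ ~ embeds (fun p q : rat => (p <= q)%R) r].

Definition downward_closed (L : set (rel nat)) : Prop :=
  forall K M, Lin K -> L M -> embeds K M -> L K.

Definition convex_in (T : Type) (r : rel T) (I : set T) : Prop :=
  I `<=` dom r /\ forall x y z, I x -> I z -> r x y -> r y z -> I y.

Definition set_le (T : Type) (r : rel T) (A B : set T) : Prop :=
  forall a b, A a -> B b -> r a b.

Definition set_lt (T : Type) (r : rel T) (A B : set T) : Prop :=
  forall a b, A a -> B b -> strict r a b.

Definition convex_partition (T U : Type) (K : rel U) (r : rel T)
    (P : U -> set T) : Prop :=
  classical_sets.partition (dom K) P (dom r) /\
  forall k k', dom K k -> dom K k' ->
    (strict K k k' <-> set_lt r (P k) (P k')).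

Definition convex_le (L : set (rel nat)) (r s : rel nat) : Prop :=
  exists K : rel nat, L K /\
  exists P : nat -> set nat, convex_partition K r P /\
  exists f : nat -> nat, is_embedding r s f /\
    forall k, dom K k -> convex_in s (f @` P k).

(* Antilexicographic order on the pairs (x, k) with k in dom K and x in F k.   *)
Definition sum_order (T U : Type) (K : rel U) (K' : rel T) (F : U -> set T) :
    rel (T * U) :=
  fun p q => `[< [/\ dom K p.2, F p.2 p.1, dom K q.2, F q.2 q.1 &
                  strict K p.2 q.2 \/ (p.2 = q.2 /\ K' p.1 q.1)] >].

(* The sum lives on pairs, so its membership in L is up to isomorphism.        *)
Definition ccs (L : set (rel nat)) : Prop :=
  forall (K K' : rel nat) (F : nat -> set nat), L K -> L K' ->
    (forall k, dom K k -> F k !=set0 /\ convex_in K' (F k)) ->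
    (forall k0 k1, dom K k0 -> dom K k1 ->
       strict K k0 k1 -> set_le K' (F k0) (F k1)) ->
    exists2 M, L M & isomorphic M (sum_order K K' F).

(* Main.v *)
Require Import Defs.
From mathcomp Require Import all_boot all_order all_algebra.
From mathcomp Require Import boolp classical_sets functions cardinality reals.
From mathcomp Require Import lra zify.

(** Fix an injection n from the rationals to the natural numbers. To a set S of
    rationals associate the linear order obtained from S by replacing each q
    in S by a block of n q + 1 consecutive points. When S is nonempty and
    right-open (every point of S is the left endpoint of an open interval
    contained in S), this order is countably infinite, hence has a copy with
    domain nat. Two facts about these orders suffice, and they do not depend
    on which class of scattered orders is considered.

    If S is an initial segment of T, the order of S is an initial segment of
    the order of T, so it is below it already by means of a partition into a
    single piece, and one-point orders belong to every nonempty downward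
    closed class [initial_segment_convex_le].

    If S contains an interval (a, b) and the order of S is below that of T,
    then T meets (a, b) [convex_le_interval_sub]. Indeed, if each piece of the
    partition met at most one block over (a, b), then sending a rational of
    (a, b) to the piece of the first point of its block would embed the
    rationals into the scattered order indexing the pieces. So some piece
    contains all blocks over a nonempty interval (u, v). These are carried onto
    a convex set, and since (u, v) and the right-open set T are densely ordered,
    each block goes onto a whole block [block_sizes_preserved]. As blocks over
    different rationals have different sizes, the block of r is sent to the
    block of r, and (u, v) is contained in T.

    The sets of rationals below x, for x real, then give the chain. For the
    antichain, a set X of natural numbers is coded by a union of unit intervals
    containing, for each k, exactly one of (2k, 2k+1) and (2k+1, 2k+2),
    the second when k belongs to X; for X different from Y, the union
    for X contains a unit interval disjoint from the union for Y. *)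

Import Order.TTheory GRing.Theory Num.Theory.

Local Open Scope classical_set_scope.
Local Open Scope card_scope.

(** * Sums of finite blocks over sets of rationals *)

(** The pair (q, i) is the i-th point of the block of q; the order is
    lexicographic, with the rational coordinate dominant. *)
Notation bpoint := (rat *l nat)%type.

(** The points of the sum over S of blocks, the block of q having n q + 1
    points. *)
Definition blocks (n : rat -> nat) (S : set rat) : set bpoint :=
  [set p | S p.1 /\ (p.2 <= n p.1)%N].

(** Half-openness to the right: it makes S dense in itself, without a greatest
    element. *)
Definition right_open (S : set rat) : Prop :=
  forall q : rat, S q ->
    exists2 q' : rat, (q < q')%R & forall r : rat, (q < r < q')%R -> S r.

(** The open interval (a, b) of rationals. *)
Definition ratitv (a b : rat) : set rat := [set r | (a < r < b)%R].

Lemma pltE (q r : rat) (i j : nat) :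
  ((q, i) < (r, j) :> bpoint)%O = (q < r)%R || (q == r) && (i < j)%N.
Proof. by rewrite ltxi_pair ltEnat; case: (ltgtP q r). Qed.

Lemma plt_adjacent (q : rat) (i : nat) (p : bpoint) :
  ~ (((q, i) : bpoint) < p < ((q, i.+1) : bpoint))%O.
Proof.
case: p => s k; rewrite !pltE => /andP[/orP[qs|/andP[/eqP <- ik]]].
  by rewrite lt_gtF //= gt_eqF.
by rewrite ltxx eqxx /= ltnS leqNgt ik.
Qed.

Lemma rat_between (a b : rat) : (a < b)%R -> exists c, (a < c < b)%R.
Proof. by move=> ab; exists ((a + b) / 2)%R; rewrite !midf_lt. Qed.

(** * Rigidity of the blocks *)

(** An order embedding of the blocks over (a, b) onto a convex set of blocks
    over T maps the block of r onto the block of some t; comparing sizes,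
    t = r. *)
Lemma block_sizes_preserved (n : rat -> nat) (T : set rat) (a b : rat) (phi : bpoint -> bpoint) :
  injective n -> right_open T ->
  (forall p, blocks n (ratitv a b) p -> blocks n T (phi p)) ->
  (forall p p', blocks n (ratitv a b) p -> blocks n (ratitv a b) p' ->
     (phi p <= phi p')%O = (p <= p')%O) ->
  (forall p p' d, blocks n (ratitv a b) p -> blocks n (ratitv a b) p' ->
     blocks n T d -> (phi p <= d <= phi p')%O ->
     exists2 p'', blocks n (ratitv a b) p'' & phi p'' = d) ->
  ratitv a b `<=` T.
Proof.
move=> n_inj Topen phiT phi_le phi_cvx r.
have phi_lt p p' : blocks n (ratitv a b) p -> blocks n (ratitv a b) p' ->
    (phi p < phi p')%O = (p < p')%O.
  by move=> Jp Jp'; rewrite !ltNge phi_le.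
have between p p' d : blocks n (ratitv a b) p -> blocks n (ratitv a b) p' ->
    blocks n T d -> (phi p < d < phi p')%O ->
    exists p'', [/\ blocks n (ratitv a b) p'', (p < p'' < p')%O & phi p'' = d].
  move=> Jp Jp' Td /andP[pd dp'].
  have [|p'' Jp'' phip''] := phi_cvx p p' d Jp Jp' Td; first by rewrite (ltW pd) (ltW dp').
  by exists p''; split=> //; rewrite -(phi_lt p) // -(phi_lt _ p') // phip'' pd.
rewrite /ratitv /= => arb.
have J_r i : (i <= n r)%N -> blocks n (ratitv a b) (r, i) by [].
have J_0 s : (a < s < b)%R -> blocks n (ratitv a b) (s, 0%N) by [].
case tj: (phi (r, 0%N)) => [t j].
have [Tt jt] : blocks n T (t, j) by rewrite -tj; exact/phiT/J_0.
rewrite /= in Tt jt.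
(* Consecutive points of a block have consecutive images, hence images in   *)
(* one block, since T is dense in itself.                                   *)
have phi_ri i : (i <= n r)%N -> phi (r, i) = (t, j + i)%N.
  elim: i => [|i IHi] ir; first by rewrite addn0.
  have {}IHi := IHi (ltnW ir).
  have no_pt d : blocks n T d -> ~ (phi (r, i) < d < phi (r, i.+1))%O.
    move=> Td /between[]; [exact/J_r/ltnW|exact: J_r|by []|].
    by move=> p [_ /plt_adjacent].
  have : (phi (r, i) < phi (r, i.+1))%O.
    rewrite phi_lt; first by rewrite pltE eqxx ltnSn orbT.
      exact/J_r/ltnW.
    exact: J_r.
  have : blocks n T (phi (r, i.+1)) by exact/phiT/J_r.
  move: no_pt; rewrite IHi; case: (phi (r, i.+1)) => t' j' no_pt [Tt' j't'].
  rewrite /= in Tt' j't'; rewrite pltE => /orP[tt'|/andP[/eqP ett' jj']].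
    have [u tu uT] := Topen t Tt.
    have [s /andP[ts]] := rat_between t (Num.min u t') ltac:(by rewrite lt_min tu).
    rewrite lt_min => /andP[su st'].
    case: (no_pt (s, 0%N)); first by split=> //=; apply: uT; rewrite ts.
    by rewrite !pltE ts st'.
  subst t'; congr (_, _); apply/eqP; rewrite addnS eqn_leq jj' andbT leqNgt.
  apply/negP => j'j; case: (no_pt (t, (j + i).+1)).
    by split=> //=; rewrite (leq_trans (ltnW j'j)).
  by rewrite !pltE !eqxx ltnSn j'j !orbT.
(* An interval of blocks has no last bpoint below r and no first bpoint above *)
(* r, hence neither does its image: the image of a block is a whole block.  *)
have no_pred d : blocks n T d -> (d < phi (r, 0%N))%O ->
    ~ (forall e, ~ (d < e < phi (r, 0%N))%O).
  move=> Td dr nod; have /andP[ar rb] := arb.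
  have [c /andP[ac cr]] := rat_between a r ar.
  have Jc : blocks n (ratitv a b) (c, 0%N) by apply: J_0; rewrite ac (lt_trans cr).
  have Jr := J_0 r arb.
  have cd : (phi (c, 0%N) <= d)%O.
    rewrite leNgt; apply/negP => dc; apply: (nod (phi (c, 0%N))).
    by rewrite dc phi_lt // pltE cr.
  have [|[s i] Jp phip] := phi_cvx _ _ d Jc Jr Td; first by rewrite cd (ltW dr).
  have sr : (s < r)%R.
    by move: dr; rewrite -phip phi_lt // pltE ltn0 andbF orbF.
  have [/= /andP[as_ _] _] := Jp.
  have [u /andP[su ur]] := rat_between s r sr.
  have Ju : blocks n (ratitv a b) (u, 0%N).
    by apply: J_0; rewrite (lt_trans as_ su) (lt_trans ur rb).
  by apply: (nod (phi (u, 0%N))); rewrite -phip !phi_lt // !pltE su ur.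
have no_succ d : blocks n T d -> (phi (r, n r) < d)%O ->
    ~ (forall e, ~ (phi (r, n r) < e < d)%O).
  move=> Td rd nod; have /andP[ar rb] := arb.
  have [c /andP[rc cb]] := rat_between r b rb.
  have Jc : blocks n (ratitv a b) (c, 0%N) by apply: J_0; rewrite cb (lt_trans ar).
  have Jr := J_r (n r) (leqnn _).
  have dc : (d <= phi (c, 0%N))%O.
    rewrite leNgt; apply/negP => cd; apply: (nod (phi (c, 0%N))).
    by rewrite cd andbT phi_lt // pltE rc.
  have [|[s i] Jp phip] := phi_cvx _ _ d Jr Jc Td; first by rewrite dc (ltW rd).
  have [/= /andP[_ sb] is_] := Jp.
  have rs : (r < s)%R.
    move: rd; rewrite -phip phi_lt // pltE => /orP[//|/andP[/eqP rs]].
    by rewrite rs ltnNge is_.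
  have [u /andP[ru us]] := rat_between r s rs.
  have Ju : blocks n (ratitv a b) (u, 0%N).
    by apply: J_0; rewrite (lt_trans ar ru) (lt_trans us sb).
  by apply: (nod (phi (u, 0%N))); rewrite -phip !phi_lt // !pltE us ru.
have j0 : j = 0%N.
  case: j => [//|j] in tj jt phi_ri *.
  case: (no_pred (t, j)); first by split=> //=; apply: ltnW.
    by rewrite tj pltE eqxx ltnSn orbT.
  by rewrite tj; apply: plt_adjacent.
have tr : n t = n r.
  have [_] := phiT _ (J_r (n r) (leqnn _)); rewrite phi_ri // j0 add0n /=.
  rewrite leq_eqVlt => /orP[/eqP //|rt].
  case: (no_succ (t, (n r).+1)); first by [].
    by rewrite phi_ri // j0 add0n pltE eqxx ltnSn orbT.
  by rewrite phi_ri // j0 add0n; apply: plt_adjacent.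
by rewrite -(n_inj _ _ tr).
Qed.

(** * Orders on the natural numbers coding sums of blocks *)

Lemma rat_embeds_in_interval (a b : rat) : (a < b)%R ->
  exists2 h : rat -> rat, (forall x, ratitv a b (h x)) &
    {mono h : x y / (x <= y)%R}.
Proof.
(* The map x / (1 + |x|) embeds the rationals into (-1, 1). *)
move=> ab; pose g (x : rat) : rat := (x / (1 + `|x|))%R.
have den x : (0 < 1 + `|x| :> rat)%R by rewrite ltr_pwDl.
have g_itv x : (-1 < g x < 1)%R.
  rewrite ltr_pdivlMr // ltr_pdivrMr //; case: (ger0P x) => x0; lra.
have g_lt : {homo g : x y / (x < y)%R}.
  move=> x y xy; rewrite /g ltr_pdivrMr // mulrAC ltr_pdivlMr //.
  by case: (ger0P x) => x0; case: (ger0P y) => y0; nra.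
exists (fun x => a + (b - a) * ((1 + g x) / 2))%R.
  move=> x; rewrite /ratitv /=; have := g_itv x; nra.
apply: le_mono => x y /g_lt; nra.
Qed.

Lemma ple_fst (p p' : bpoint) : (p <= p')%O -> (p.1 <= p'.1)%R.
Proof. by case: p p' => [q i] [r j]; rewrite lexi_pair => /andP[]. Qed.

(** The order on the natural numbers pulled back along e. *)
Definition order_of (e : nat -> bpoint) : rel nat := fun m k => (e m <= e k)%O.

(** The map e is a bijection from the natural numbers onto the blocks over S,
    so that order_of e is a copy with domain nat of the sum of these blocks. *)
Definition enumerates (n : rat -> nat) (S : set rat) (e : nat -> bpoint) : Prop :=
  injective e /\ range e = blocks n S.

Lemma enumeration_exists (n : rat -> nat) (S : set rat) :
  right_open S -> S !=set0 -> exists e, enumerates n S e.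
Proof.
move=> Sopen [a Sa]; have [b ab Sab] := Sopen a Sa.
have [h hab hmono] := rat_embeds_in_interval a b ab.
have leD : [set: nat] #<= blocks n S.
  apply: (@card_le_trans _ _ _ [set (h k%:R%R, 0%N) | k in [set: nat]]).
    have inj : {in [set: nat] &, injective (fun k : nat => (h k%:R%R, 0%N) : bpoint)}.
      by move=> k l _ _ [] /(inc_inj hmono) /eqP; rewrite eqr_nat => /eqP.
    by have /card_eqPle[] := inj_card_eq inj.
  apply: subset_card_le => _ [k _ <-]; split=> //=; exact/Sab/hab.
have := eq_card_nat (countableP _) ((infiniteP _).2 leD).
move=> /card_set_bijP[f [_ f_inj f_onto]].
have /choice[e eP] (k : nat) : exists p, blocks n S p /\ f p = k.
  by have [p ? ?] := f_onto k I; exists p.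
exists e; split; first by move=> k l ekl; have [_ <-] := eP k; rewrite ekl; case: (eP l).
apply/seteqP; split=> [_ [k _ <-]|p Sp]; first by case: (eP k).
have [Sq fq] := eP (f p).
by exists (f p) => //; apply: f_inj fq; rewrite in_setE.
Qed.

Lemma dom_order_of (e : nat -> bpoint) : dom (order_of e) = setT.
Proof. by apply/seteqP; split=> // k _; rewrite /dom /order_of /= lexx. Qed.

Lemma order_of_LO (e : nat -> bpoint) : injective e -> LO (order_of e).
Proof.
move=> einj; split; last exact: dom_order_of.
split; rewrite ?dom_order_of //.
- by move=> k l kl lk; apply/einj/le_anti; apply/andP.
- by move=> k l m; apply: le_trans.
- by move=> k l _ _; apply/orP/le_total.
Qed.

Lemma singleton_mem (L : set (rel nat)) :
  L `<=` Scat -> L !=set0 -> downward_closed L ->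
  exists2 K, L K & dom K = [set 0%N].
Proof.
move=> LScat [M LM] Ldown; pose K : rel nat := fun k l => (k == 0%N) && (l == 0%N).
have domK : dom K = [set 0%N].
  by apply/seteqP; split=> k; rewrite /dom /K /=; [case/andP=> /eqP|move=> ->].
exists K => //; apply: (Ldown _ M) => //.
  left; split; last by rewrite domK; exact: finite_set1.
  split; rewrite ?domK /K.
  - by exists 0%N.
  - by move=> k l /andP[/eqP-> /eqP->].
  - by move=> k l /andP[/eqP-> /eqP->].
  - by move=> k l m /andP[-> _] /andP[_ ->].
  - by move=> _ _ -> ->; left.
have [[x Mx] _ _ _ _] : is_linear_order M by case: (LScat _ LM) => -[] [].
exists (fun=> x) => k l; rewrite domK => -> ->.
by rewrite /K /=; apply/esym; exact: Mx.
Qed.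

(** * Comparison of sums of blocks *)

Lemma initial_segment_convex_le (L : set (rel nat)) (n : rat -> nat)
    (S T : set rat) (e d : nat -> bpoint) :
  L `<=` Scat -> L !=set0 -> downward_closed L ->
  enumerates n S e -> enumerates n T d ->
  S `<=` T -> (forall q r, S r -> T q -> (q <= r)%R -> S q) ->
  convex_le L (order_of e) (order_of d).
Proof.
move=> LScat L0 Ldown [einj eS] [dinj dT] ST Sinit.
have [K LK domK] := singleton_mem _ LScat L0 Ldown.
have /choice[f fE] (k : nat) : exists l, d l = e k.
  have [Sk kn] : blocks n S (e k) by rewrite -eS; exists k.
  suff [l _ <-] : range d (e k) by exists l.
  by rewrite dT; split=> //; exact: ST.
exists K; split=> //; exists (fun=> setT); split.
  split; last first.
    move=> k l; rewrite domK => -> ->; split=> [[_ []//]|].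
    by move=> /(_ 0%N 0%N I I)[_ []].
  split; rewrite ?domK /cover ?bigcup_set1 ?dom_order_of //.
  by move=> k l -> ->.
exists f; split; first by move=> k l _ _; rewrite /order_of !fE.
move=> _ _; split; first by rewrite dom_order_of.
move=> _ y _ [k _ <-] [l _ <-] _; rewrite /order_of fE => yl.
have [Ty yn] : blocks n T (d y) by rewrite -dT; exists y.
have [Sl _] : blocks n S (e l) by rewrite -eS; exists l.
have [m _ my] : range e (d y).
  rewrite eS; split=> //; apply: (Sinit _ (e l).1) => //.
  exact: ple_fst yl.
by exists m => //; apply: dinj; rewrite fE.
Qed.

(** The obstruction: scatteredness of the index order forces one piece to
    contain all blocks over a nonempty subinterval of (a, b), and these blocks
    must occur over T. *)
Lemma convex_le_interval_sub (L : set (rel nat)) (n : rat -> nat)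
    (S T : set rat) (e d : nat -> bpoint) (a b : rat) :
  L `<=` Scat -> injective n ->
  enumerates n S e -> enumerates n T d -> right_open T ->
  (a < b)%R -> ratitv a b `<=` S ->
  convex_le L (order_of e) (order_of d) ->
  exists2 q, ratitv a b q & T q.
Proof.
move=> LScat n_inj [einj eS] [dinj dT] Topen ab abS.
move=> [K [LK [P [[[Pcover Ptriv P0] Plt] [f [fE fcvx]]]]]].
have [[_ Kdom Kanti Ktrans Ktot] Kscat] :
    is_linear_order K /\ ~ embeds (fun p q : rat => (p <= q)%R) K.
  by case: (LScat _ LK) => -[] [].
have piece k : exists i, dom K i /\ P i k.
  suff [i Ki Pik] : cover (dom K) P k by exists i.
  by rewrite Pcover dom_order_of.
(* The pieces are ordered as their points are. *)
have piece_lt i j k l : dom K i -> dom K j -> P i k -> P j l ->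
    (e k < e l)%O -> K i j.
  move=> Ki Kj Pk Pl kl; have [//|Kji] := Ktot i j Ki Kj.
  have [-> //|/eqP ij] := eqVneq i j.
  have /(Plt j i Kj Ki) /(_ l k Pl Pk)[] : strict K j i by split=> // /esym.
  by rewrite /order_of leNgt kl.
have code q : S q -> exists k, e k = (q, 0%N).
  move=> Sq; suff [k _ <-] : range e (q, 0%N) by exists k.
  by rewrite eS; split.
(* Some piece meets two different blocks over (a, b); otherwise the rationals *)
(* would embed into K.                                                       *)
have [i [k [l [[Ki Pik Pil] [abk abl kl]]]]] : exists i k l,
    [/\ dom K i, P i k & P i l] /\ [/\ ratitv a b (e k).1, ratitv a b (e l).1 &
        ((e k).1 < (e l).1)%R].
  apply: contrapT => noP; apply: Kscat.
  have [h hab hmono] := rat_embeds_in_interval a b ab.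
  have /choice[g gP] (x : rat) :
      exists i, dom K i /\ exists2 k, P i k & e k = (h x, 0%N).
    have [k ek] := code _ (abS _ (hab x)).
    by have [i [Ki Pik]] := piece k; exists i; split=> //; exists k.
  have g_lt x y : (x < y)%R -> K (g x) (g y) /\ g x <> g y.
    have [Kx [k Pk ek]] := gP x; have [Ky [l Pl el]] := gP y => xy.
    have hxy : (h x < h y)%R by rewrite (leW_mono hmono).
    split; first by apply: piece_lt Pk Pl _; rewrite ?ek ?el ?pltE ?hxy.
    move=> gxy; apply: noP; exists (g x), k, l; rewrite ek el.
    by split; split; rewrite // ?gxy //; exact: hab.
  exists g => x y _ _; case: (ltgtP x y) => [/g_lt[]//|/g_lt[Kyx nyx]|->].
    by apply/esym/negP => Kxy; apply/nyx/Kanti.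
  by have [] := gP y.
(* Pieces are convex. *)
have Kk m : (e k < e m < e l)%O -> P i m.
  move=> /andP[km ml]; have [j [Kj Pjm]] := piece m.
  by rewrite (Kanti i j (piece_lt _ _ _ _ Ki Kj Pik Pjm km)
                       (piece_lt _ _ _ _ Kj Ki Pjm Pil ml)).
set u := (e k).1 in abk kl *; set v := (e l).1 in abl kl *.
have uvab : ratitv u v `<=` ratitv a b.
  move=> q /andP[uq qv]; move: abk abl; rewrite /ratitv /= => /andP[au _] /andP[_ vb].
  by rewrite (lt_trans au uq) (lt_trans qv vb).
(* The inverse of e on the blocks over (u, v); its values elsewhere are *)
(* irrelevant.                                                          *)
have /choice[c cE] (p : bpoint) : exists m, blocks n (ratitv u v) p -> e m = p.
  have [[uvp pn]|] := pselect (blocks n (ratitv u v) p); last by exists 0%N.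
  suff [m _ mp] : range e p by exists m.
  by rewrite eS; split=> //; exact/abS/uvab.
have cP p : blocks n (ratitv u v) p -> P i (c p).
  move=> Jp; apply: Kk; rewrite cE //; case: Jp => /andP[up pv] _.
  rewrite /u /v in up pv *; case: (e k) (e l) p up pv => [? ?] [? ?] [? ?] /= up pv.
  by rewrite !pltE up pv.
have f_le m m' : (d (f m) <= d (f m'))%O = (e m <= e m')%O.
  by rewrite -[RHS]/(order_of e m m') fE ?dom_order_of.
have uvT : ratitv u v `<=` T.
  apply: (block_sizes_preserved n T u v (fun p => d (f (c p)))) => //.
  - by move=> p _; rewrite -dT; exists (f (c p)).
  - by move=> p p' Jp Jp'; rewrite f_le !cE.
  - move=> p p' x Jp Jp' Tx /andP[px xp'].
    have [y _ yx] : range d x by rewrite dT.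
    have [_ /(_ (f (c p)) y (f (c p')))] := fcvx i Ki.
    rewrite /order_of yx px xp' => -[||//|//|m Pm fm].
    + by exists (c p) => //; exact: cP.
    + by exists (c p') => //; exact: cP.
    have ple : (p <= e m <= p')%O.
      by rewrite -{1}(cE p Jp) -(cE p' Jp') -!f_le fm yx px.
    have Jm : blocks n (ratitv u v) (e m).
      have [_ emn] : blocks n S (e m) by rewrite -eS; exists m.
      move: ple Jp Jp' => /andP[/ple_fst pm /ple_fst mp'] [/andP[up _] _] [/andP[_ pv] _].
      by split=> //; rewrite /ratitv /= (lt_le_trans up pm) (le_lt_trans mp' pv).
    by exists (e m) => //; rewrite -yx -fm; congr (d (f _)); apply: einj; rewrite cE.
have [q uvq] := rat_between u v kl.
by exists q; [exact: uvab|exact: uvT].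
Qed.

(** * Coding sets of natural numbers by unions of unit intervals *)

(** The union, over k, of (2k+1, 2k+2) if k belongs to X and of (2k, 2k+1)
    otherwise. *)
Definition parity_intervals (X : set nat) : set rat :=
  [set q | exists2 m : nat, ratitv m%:R (m.+1)%:R q & (odd m <-> X m./2)].

Lemma right_open_parity_intervals (X : set nat) : right_open (parity_intervals X).
Proof.
move=> q [m /andP[mq qm] Xm]; exists (m.+1)%:R%R => // r /andP[qr rm].
by exists m => //; rewrite /ratitv /= (lt_trans mq qr).
Qed.

Lemma parity_intervals_code (X : set nat) (k : nat) :
  exists2 m, (odd m <-> X m./2) & m./2 = k.
Proof.
have [Xk|Xk] := pselect (X k); [exists k.*2.+1|exists k.*2];
  rewrite /= ?odd_double ?uphalf_double ?doubleK //=.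
Qed.

Lemma unit_ratitv_inj (m l : nat) (q : rat) :
  ratitv m%:R (m.+1)%:R q -> ratitv l%:R (l.+1)%:R q -> m = l.
Proof.
move=> /andP[mq qm] /andP[lq ql].
have := lt_trans mq ql; have := lt_trans lq qm; rewrite !ltr_nat; lia.
Qed.

Lemma parity_intervals_not_sub (X Y : set nat) : X <> Y ->
  exists2 m : nat, ratitv m%:R (m.+1)%:R `<=` parity_intervals X &
    forall q, ratitv m%:R (m.+1)%:R q -> ~ parity_intervals Y q.
Proof.
move=> XY; have [k nXYk] : exists k, ~ (X k <-> Y k).
  by apply: contrapT => /forallNP XYk; apply/XY/seteqP; split=> k;
    have /contrapT[] := XYk k.
have [m Xm mk] := parity_intervals_code X k.
exists m => [q mq|q mq [l lq Yl]]; first by exists m.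
apply: nXYk; rewrite -(unit_ratitv_inj _ _ _ mq lq) mk in Yl.
by rewrite mk in Xm; rewrite -Xm -Yl.
Qed.

(** * Chains and antichains *)

Theorem theorem5p2 (R : realType) (L : set (rel nat)) :
  L `<=` Scat -> L !=set0 -> downward_closed L -> ccs L ->
  (exists F : R -> rel nat,
     (forall x, LO (F x)) /\
     (forall x y, convex_le L (F x) (F y) <-> (x <= y)%R)) /\
  (exists A : set (rel nat),
     [/\ A `<=` LO,
         A #= [set: set nat] &
         forall r s, A r -> A s -> r <> s ->
           ~ convex_le L r s /\ ~ convex_le L s r]).
Proof.
move=> LScat L0 Ldown _.
have [n n_inj] : exists n : rat -> nat, injective n.
  by exists pickle; exact: pcan_inj pickleK.
split.
  pose S (x : R) : set rat := [set q | (ratr q < x)%R].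
  have Sopen x : right_open (S x).
    move=> q qx; have [q' /andP[]] := rat_in_itvoo qx.
    rewrite !bnd_simp ltr_rat => qq' q'x; exists q' => // r /andP[_ rq'].
    by apply: lt_trans q'x; rewrite ltr_rat.
  have S0 x : S x !=set0.
    have x1x : (x - 1 < x)%R by rewrite ltrBlDr ltrDl.
    have [q /andP[_]] := rat_in_itvoo x1x.
    by rewrite bnd_simp; exists q.
  have /choice[e eP] x := enumeration_exists n (S x) (Sopen x) (S0 x).
  exists (fun x => order_of (e x)); split=> [x|x y].
    by apply: order_of_LO; case: (eP x).
  split=> [exy|xy].
    rewrite leNgt; apply/negP => yx.
    have [a /andP[]] := rat_in_itvoo yx; rewrite !bnd_simp => ya ax.
    have [b /andP[]] := rat_in_itvoo ax; rewrite !bnd_simp ltr_rat => ab bx.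
    have [|q /andP[aq _] qy] := convex_le_interval_sub L n (S x) (S y) _ _ a b LScat
      n_inj (eP x) (eP y) (Sopen y) ab _ exy.
      by move=> r /andP[_ rb]; apply: lt_trans bx; rewrite ltr_rat.
    have raq : (ratr a < ratr q :> R)%R by rewrite ltr_rat.
    by have := lt_trans (lt_trans ya raq) qy; rewrite ltxx.
  apply: (initial_segment_convex_le L n (S x) (S y)) => //.
    by move=> q qx; apply: lt_le_trans xy.
  by move=> q r rx _ qr; apply: le_lt_trans rx; rewrite ler_rat.
have S0 X : parity_intervals X !=set0.
  have [m Xm _] := parity_intervals_code X 0.
  have [|q mq] := rat_between m%:R m.+1%:R; first by rewrite ltr_nat.
  by exists q, m.
have /choice[e eP] X := enumeration_exists n _ (right_open_parity_intervals X) (S0 X).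
have anti X Y : X <> Y -> ~ convex_le L (order_of (e X)) (order_of (e Y)).
  move=> /parity_intervals_not_sub[m mX mY] leXY.
  have [|q /mY] := convex_le_interval_sub L n _ _ _ _ m%:R m.+1%:R LScat
    n_inj (eP X) (eP Y) (right_open_parity_intervals Y) _ mX leXY; last by [].
  by rewrite ltr_nat.
exists (range (fun X => order_of (e X))); split.
- by move=> _ [X _ <-]; apply: order_of_LO; case: (eP X).
- apply: inj_card_eq => X Y _ _ XY; apply: contrapT => nXY.
  have refl : convex_le L (order_of (e X)) (order_of (e X)).
    by apply: (initial_segment_convex_le L n _ _).
  by apply: (anti X Y nXY); rewrite -XY.
- move=> _ _ [X _ <-] [Y _ <-] XY.
  by split; apply: anti => E; apply: XY; rewrite E.
Qed.
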